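(* For every integer $n\ge 2$, $$\mathcal{C}(\mathbb{Z}/n\mathbb{Z})=\max\left\{m\in\mathbb{N}:\sum_{\substack{d\mid n\\ d>m}}\varphi(d)\ge m\right\},$$ where the sum runs over positive divisors $d$ of $n$ with $d>m$. In particular, $$\varphi(n)\le \mathcal{C}(\mathbb{Z}/n\mathbb{Z})\le n-1.$$
   Context: For an element $x$ of a finite group $G$, $\operatorname{ord}(x)$ denotes its order (for $\mathbb{Z}/n\mathbb{Z}$, the additive order). A nonempty subset $S\subseteq G$ is called a Chowla set if $\operatorname{ord}(x)>|S|$ for every $x\in S$. Define $\mathcal{C}(G)=\max\{|S|:S\subseteq G\text{ is a Chowla set}\}$. $\varphi$ is Euler's totient function. *)

(* Defs.v *)
From mathcomp Require Import all_boot all_fingroup.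

Set Implicit Arguments.
Unset Strict Implicit.
Unset Printing Implicit Defensive.

Local Open Scope group_scope.

Definition chowla_set (gT : finGroupType) (G : {group gT}) (S : {set gT}) :=
  [&& S != set0, S \subset G & [forall x in S, #|S| < #[x]]].

(* The maximum over an empty family is 0; this only concerns the trivial group,
   since a singleton {x} with x != 1 is a Chowla set. *)
Definition chowla_number (gT : finGroupType) (G : {group gT}) : nat :=
  \max_(S : {set gT} | chowla_set G S) #|S|.

Definition is_max_nat (P : pred nat) (m : nat) : Prop :=
  P m /\ (forall k : nat, P k -> k <= m).

(* Main.v *)
Require Import Defs.
From mathcomp Require Import all_boot all_fingroup all_algebra.
From mathcomp Require Import cyclic.

(** In any finite group G, whether Chowla sets of size m exist is a counting
    question.  A Chowla set of size m > 0 is nothing but an m-element subset of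
    the set of all x in G with #[x] > m, so one exists exactly when that set
    has at least m elements.  Hence the Chowla number is the largest m with
    m <= #|{x in G : #[x] > m}| ([chowla_number_max_order_gt]).

    If G is cyclic, then it has a single subgroup of each order d dividing #|G|,
    and the elements of order d are the generators of that subgroup, totient d
    in number.  Grouping elements by their order turns the count above into the
    sum of totient d over the divisors d > m ([card_order_gt_cyclic]).

    Both bounds are read off this description.  With m = totient n < n the term
    d = n alone makes the sum at least m; and for m >= n the sum is empty, so
    that only m = 0 could satisfy the inequality. *)

(** Among subsets of a given size m, being a Chowla set is a condition on each
    element separately, so any m elements of order greater than m form one. *)
Lemma chowla_number_max_order_gt (gT : finGroupType) (G : {group gT}) :
  is_max_nat (fun m => m <= #|[set x in G | m < #[x]%g]|) (chowla_number G).
Proof.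
rewrite /chowla_number; split=> [|m /card_geqP[s [s_uniq s_size s_sub]]].
  apply: (big_ind (fun m => m <= #|[set x in G | m < #[x]%g]|)) => //
    [m1 m2 le_m1 le_m2 | S /and3P[_ sSG /forall_inP ltS]].
    by case: (leqP m1 m2).
  apply/subset_leq_card/subsetP=> x Sx.
  by rewrite inE (subsetP sSG) // ltS.
have [-> // | m_gt0] := posnP m.
have card_s: #|[set x in s]| = m by rewrite cardsE (card_uniqP s_uniq).
apply: (bigmax_sup [set x in s]); last by rewrite card_s.
apply/and3P; split; first by rewrite -card_gt0 card_s.
  by apply/subsetP=> x; rewrite inE => /s_sub; rewrite inE => /andP[].
by apply/forall_inP=> x; rewrite card_s inE => /s_sub; rewrite inE => /andP[].
Qed.

(** A cyclic group has only one subgroup of order d, so the elements of order d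
    are the generators of a single cyclic group. *)
Lemma card_order_eq_cyclic (gT : finGroupType) (G : {group gT}) (d : nat) :
  cyclic G -> d %| #|G| -> #|[set x in G | #[x]%g == d]| = totient d.
Proof.
case/cyclicP=> a defG; rewrite defG => d_dvd; set b := (a ^+ (#[a] %/ d))%g.
have ord_b: #[b]%g = d.
  by rewrite orderXdiv ?dvdn_div // divnA // mulKn // order_gt0.
have sbG: <[b]>%g \subset <[a]>%g by rewrite cycle_subG mem_cycle.
rewrite -[in RHS]ord_b totient_gen; apply: eq_card => x; rewrite !inE.
apply/andP/idP=> [[Gx /eqP ord_x] | gen_x].
  rewrite /generator (eq_subG_cyclic (cycle_cyclic a)) ?cycle_subG //.
    by rewrite -!orderE ord_b ord_x.
  by rewrite -cycle_subG.
rewrite (subsetP sbG) ?cycle_generator //.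
by rewrite -(generator_order gen_x) ord_b.
Qed.

Lemma card_order_gt_cyclic (gT : finGroupType) (G : {group gT}) (m : nat) :
  cyclic G ->
  #|[set x in G | m < #[x]%g]| = \sum_(d <- divisors #|G| | m < d) totient d.
Proof.
move=> cycG; rewrite -sum1_card.
have in_div x : x \in G -> #[x]%g \in divisors #|G|.
  by move=> Gx; rewrite -dvdn_divisors ?cardG_gt0 // order_dvdG.
(* Each x is counted once, at the position of #[x] in the list of divisors. *)
transitivity (\sum_(x in [set x in G | m < #[x]%g])
                \sum_(d <- divisors #|G| | m < d) (#[x]%g == d : nat)).
  apply: eq_bigr => x; rewrite inE => /andP[Gx lt_m].
  rewrite big_mkcond (bigD1_seq #[x]%g) ?divisors_uniq ?in_div //= lt_m eqxx.
  rewrite big1 // => d /negbTE ne_d; rewrite eq_sym ne_d.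
  by case: ifP.
rewrite exchange_big /= big_seq_cond [RHS]big_seq_cond.
apply: eq_bigr => d /andP[].
rewrite -dvdn_divisors ?cardG_gt0 // => d_dvd lt_m.
rewrite -(card_order_eq_cyclic _ _ _ cycG d_dvd) -sum1_card.
rewrite big_mkcond [RHS]big_mkcond; apply: eq_bigr => x _; rewrite !inE.
by have [->|_] := eqVneq #[x]%g d; rewrite ?lt_m ?andbT ?andbF // if_same.
Qed.

(** The identity of a nontrivial cyclic group is not a generator. *)
Lemma totient_lt_card_cyclic (gT : finGroupType) (G : {group gT}) :
  cyclic G -> 1 < #|G| -> totient #|G| < #|G|.
Proof.
move=> cycG G_gt1; rewrite -(card_order_eq_cyclic _ _ _ cycG (dvdnn _)).
apply/proper_card/properP; split.
  by apply/subsetP=> x; rewrite inE => /andP[].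
by exists 1%g; rewrite ?inE ?group1 // order1 neq_ltn G_gt1.
Qed.

(* [set: 'Z_n] is the additive group Z/nZ, so the order #[x] used in
   chowla_number is the additive order; 'Z_n is Z/nZ because 1 < n. *)
Theorem theorem2p4 (n : nat) (hn : 1 < n) :
  is_max_nat (fun m : nat => m <= \sum_(d <- divisors n | m < d) totient d)
    (chowla_number [set: 'Z_n]%G)
  /\ totient n <= chowla_number [set: 'Z_n]%G <= n - 1.
Proof.
have n_gt0 : 0 < n by apply: ltnW.
have cycZ : cyclic [set: 'Z_n] by apply/cyclicP; exists Zp1; apply: Zp_cycle.
have cardZ : #|[set: 'Z_n]| = n by rewrite cardsT card_ord Zp_cast.
have card_gt m : #|[set x in [set: 'Z_n] | m < #[x]%g]|
    = \sum_(d <- divisors n | m < d) totient d.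
  by rewrite (card_order_gt_cyclic _ _ _ cycZ) cardZ.
have [C_le C_max] := chowla_number_max_order_gt _ [set: 'Z_n]%G.
rewrite card_gt in C_le.
split; first by split=> // m; rewrite -card_gt; apply: C_max.
apply/andP; split.
  apply: C_max; rewrite card_gt.
  have lt_tot : totient n < n.
    by have := totient_lt_card_cyclic _ [set: 'Z_n]%G cycZ; rewrite cardZ; apply.
  rewrite big_mkcond (bigD1_seq n) ?divisors_uniq -?dvdn_divisors //=.
  by rewrite lt_tot leq_addr.
rewrite subn1 -ltnS prednK // ltnNge; apply/negP=> le_n.
move: C_le; rewrite big_seq_cond big1 => [|d /andP[]].
  by rewrite leqNgt (leq_trans n_gt0 le_n).
rewrite -dvdn_divisors // => /dvdn_leq d_le lt_d.
by have:= leq_trans lt_d (leq_trans (d_le n_gt0) le_n); rewrite ltnn.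
Qed.
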